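(* Let $X=X_1X_2\cdots X_n$ and $Y=Y_1Y_2\cdots Y_n$ be the first $n$ letters of two independent sequences $\{X_i\}_{i\in\mathbb{N}}$, $\{Y_i\}_{i\in\mathbb{N}}$ of i.i.d. Bernoulli random variables with parameter $1/2$. Let the scoring function satisfy $s(1,0)=s(0,1)=0$, $s(0,0)=1$, with gap penalty $q=0$, and let $L_n$ denote the optimal alignment score of $X$ and $Y$. Then there exist constants $c>0$ and $s>0$ such that, whenever $s(1,1)\geq s$, $$\mathrm{Var}(L_n)\geq c\, n \quad\text{for all } n\in\mathbb{N}.$$
   Context: An alignment of two strings $x=x_1\cdots x_n$, $y=y_1\cdots y_n$ is a pair of strictly increasing sequences $1\le \pi(1)<\cdots<\pi(k)\le n$ and $1\le\nu(1)<\cdots<\nu(k)\le n$ (for some $0\le k\le n$). Its score is $S_{(\pi,\nu)}=\sum_{i=1}^k s(x_{\pi(i)},y_{\nu(i)})$ (unaligned letters contribute nothing, since the gap penalty is $0$). The optimal alignment score is the maximum of $S_{(\pi,\nu)}$ over all alignments; an alignment attaining it is called optimal. *)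

(* Defs.v *)
From mathcomp Require Import all_boot all_order all_algebra.
From mathcomp Require Import reals.
Set Implicit Arguments. Unset Strict Implicit. Unset Printing Implicit Defensive.
Import Order.TTheory GRing.Theory Num.Theory.
Local Open Scope ring_scope.

(* Letters are bits: false = 0, true = 1.  A word of length n is a finite
   function 'I_n -> bool (position i : 'I_n is the paper's position i+1). *)

(* An alignment of length k (k <= n): strictly increasing index maps
   pi, nu : {0,..,k-1} -> {0,..,n-1}.  We encode k : 'I_n.+1 and the maps as
   finite functions on 'I_n whose values at indices >= k are irrelevant. *)
Definition is_alignment (n : nat) (k : 'I_n.+1) (pi nu : {ffun 'I_n -> 'I_n}) : bool :=
  [forall i : 'I_n, forall j : 'I_n,
     ((i < j)%N && (j < k)%N) ==> ((pi i < pi j)%N && (nu i < nu j)%N)].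

Definition align_score (R : numDomainType) (s : bool -> bool -> R) (n : nat)
  (x y : {ffun 'I_n -> bool}) (k : 'I_n.+1) (pi nu : {ffun 'I_n -> 'I_n}) : R :=
  \sum_(i < n | (i < k)%N) s (x (pi i)) (y (nu i)).

(* Optimal alignment score: the maximum of the scores over all alignments.
   The empty alignment (k = 0, score 0) is always admissible, so starting the
   max at 0 gives exactly the maximum. *)
Definition opt_score (R : realDomainType) (s : bool -> bool -> R) (n : nat)
  (x y : {ffun 'I_n -> bool}) : R :=
  \big[Num.max/0]_(a : 'I_n.+1 * {ffun 'I_n -> 'I_n} * {ffun 'I_n -> 'I_n}
                    | is_alignment a.1.1 a.1.2 a.2)
     align_score s x y a.1.1 a.1.2 a.2.

(* X_1..X_n, Y_1..Y_n independent i.i.d. Bernoulli(1/2): (X,Y) is uniformly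
   distributed on {0,1}^n x {0,1}^n (4^n outcomes, each of probability 4^-n). *)
Definition mean_Ln (R : realFieldType) (s : bool -> bool -> R) (n : nat) : R :=
  (4%:R ^+ n)^-1 * \sum_(x : {ffun 'I_n -> bool}) \sum_(y : {ffun 'I_n -> bool})
                     opt_score s x y.

Definition var_Ln (R : realFieldType) (s : bool -> bool -> R) (n : nat) : R :=
  (4%:R ^+ n)^-1 * \sum_(x : {ffun 'I_n -> bool}) \sum_(y : {ffun 'I_n -> bool})
                     (opt_score s x y - mean_Ln s n) ^+ 2.

(* Main.v *)
(** Let [Z] count the zeros of a word and [g = 1 - 4 Z(X) Z(Y) / N^2], where
    [N] is the length.  Then [E g = 0] and [E g^2 = (1 + 1/N)^2 - 1 <= 3 / N],
    so [Var L_N >= (E (L_N g))^2 / E g^2] reduces everything to a constant lower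
    bound on [E (L_N g)], which equals [E L_N] minus the average over the
    positions [i, j] of [E (L_N | X_i = Y_j = 0)].  Deleting two zeros lowers
    the optimal score by at most 2, so that conditional mean is at most
    [E L_(N-1) + 2]; appending one letter to each word gives
    [E L_N >= E L_(N-1) + (1 + s(1,1)) / 4].  Hence [E (L_N g) >= 1] as soon as
    [s(1,1) >= 11]. *)

Require Import Defs.
From mathcomp Require Import all_boot all_order all_algebra.
From mathcomp Require Import reals.
From mathcomp Require Import zify ring lra.
Set Implicit Arguments. Unset Strict Implicit. Unset Printing Implicit Defensive.
Import Order.TTheory GRing.Theory Num.Theory.
Local Open Scope ring_scope.

(** * Alignments as sorted lists of pairs *)

(** A list of pairs sorted for this order is exactly an alignment, freed of the irrelevant values
    beyond [k] in the finite-function encoding. *)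
Definition pair_lt {n : nat} (p q : 'I_n * 'I_n) : bool :=
  (p.1 < q.1)%N && (p.2 < q.2)%N.

Lemma pair_lt_trans (n : nat) : transitive (@pair_lt n).
Proof.
move=> q p r /andP[pq1 pq2] /andP[qr1 qr2].
by rewrite /pair_lt (ltn_trans pq1 qr1) (ltn_trans pq2 qr2).
Qed.

Lemma sorted_pair_lt_uniq1 (n : nat) (t : seq ('I_n * 'I_n)) :
  sorted pair_lt t -> uniq (map fst t).
Proof.
move=> st; apply: (@sorted_uniq _ (fun i j : 'I_n => (i < j)%N)).
- by move=> j i k; apply: ltn_trans.
- by move=> i; rewrite ltnn.
- by rewrite sorted_map; apply: sub_sorted st => p q /andP[].
Qed.

Lemma sorted_pair_lt_uniq2 (n : nat) (t : seq ('I_n * 'I_n)) :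
  sorted pair_lt t -> uniq (map snd t).
Proof.
move=> st; apply: (@sorted_uniq _ (fun i j : 'I_n => (i < j)%N)).
- by move=> j i k; apply: ltn_trans.
- by move=> i; rewrite ltnn.
- by rewrite sorted_map; apply: sub_sorted st => p q /andP[].
Qed.

Definition pairs_score {R : realDomainType} (s : bool -> bool -> R)
    {n : nat} (x y : {ffun 'I_n -> bool})
  (t : seq ('I_n * 'I_n)) : R := \sum_(p <- t) s (x p.1) (y p.2).

Lemma opt_score_ge0 (R : realDomainType) (s : bool -> bool -> R)
    (n : nat) (x y : {ffun 'I_n -> bool}) :
  0 <= opt_score s x y.
Proof. exact: bigmax_ge_id. Qed.

(** Reading the list through [nth] yields the two index maps. The first coordinates are distinct, so
    the length is at most [n]. *)
Lemma pairs_score_le_opt (R : realDomainType) (s : bool -> bool -> R)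
    (n : nat) (x y : {ffun 'I_n -> bool})
    (t : seq ('I_n * 'I_n)) :
  sorted pair_lt t -> pairs_score s x y t <= opt_score s x y.
Proof.
(* ['I_n] may be empty, so the default for [nth] has to come from the list itself. *)
case: t => [|p0 t0]; first by rewrite /pairs_score big_nil opt_score_ge0.
set t := p0 :: t0 => st.
have szt : (size t < n.+1)%N.
  rewrite ltnS -(size_map fst t) -(card_uniqP (sorted_pair_lt_uniq1 st)).
  by rewrite -[X in (_ <= X)%N](card_ord n) max_card.
pose a := (Ordinal szt, [ffun i : 'I_n => (nth p0 t i).1],
           [ffun i : 'I_n => (nth p0 t i).2]).
have -> : pairs_score s x y t = align_score s x y a.1.1 a.1.2 a.2.
  rewrite /pairs_score (big_nth p0) big_mkord /align_score /=.
  rewrite (big_ord_widen _ (fun i => s (x (nth p0 t i).1) (y (nth p0 t i).2))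
             (szt : (size t <= n)%N)).
  by apply: eq_bigr => i _; rewrite !ffunE.
apply: (le_bigmax_cond _ (fun a => align_score s x y a.1.1 a.1.2 a.2)).
apply/forallP => i; apply/forallP => j; apply/implyP => /andP[ij jk].
rewrite !ffunE; apply/andP.
have /andP[] // : pair_lt (nth p0 t i) (nth p0 t j).
apply: (sorted_ltn_nth (@pair_lt_trans n)) => //.
by rewrite inE (ltn_trans ij jk).
Qed.

Lemma opt_score_attained (R : realDomainType) (s : bool -> bool -> R)
    (n : nat) (x y : {ffun 'I_n -> bool}) :
  exists2 t, sorted pair_lt t & opt_score s x y = pairs_score s x y t.
Proof.
rewrite /opt_score.
apply: (big_rec (fun v => exists2 t, sorted pair_lt t & v = pairs_score s x y t)).
  by exists [::] => //; rewrite /pairs_score big_nil.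
move=> [[k pi] nu] v /= al [t st ->].
rewrite /Order.max; case: ifP => _; first by exists t.
(* Only indices below [k] are listed, since the maps are unconstrained beyond. *)
exists [seq (pi i, nu i) | i <- [seq i : 'I_n <- enum 'I_n | (i < k)%N]].
  have tr : transitive (fun i j : 'I_n => (i < j)%N).
    by move=> j i l; apply: ltn_trans.
  rewrite sorted_map.
  apply: (@sub_in_sorted _ (fun i : 'I_n => (i < k)%N)
           (fun i j : 'I_n => (i < j)%N)).
  - move=> i j _ jk ij; have {}jk : (j < k)%N := jk.
    by move/forallP/(_ i)/forallP/(_ j): al; rewrite ij jk.
  - exact: filter_all.
  - apply: sorted_filter => //.
    by have := iota_ltn_sorted 0 n; rewrite -val_enum_ord sorted_map.
by rewrite /pairs_score big_map big_filter big_enum_cond.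
Qed.

(** * Effect of appending and deleting letters on the optimal score *)

Definition remove_letter {n : nat} (i : 'I_n.+1) (x : {ffun 'I_n.+1 -> bool}) :
  {ffun 'I_n -> bool} := [ffun k => x (lift i k)].

Lemma ltn_lift (n : nat) (i : 'I_n.+1) (a b : 'I_n) :
  (lift i a < lift i b)%N = (a < b)%N.
Proof. by rewrite /= /bump; case: (leqP i a); case: (leqP i b); lia. Qed.

Lemma pair_lt_lift (n : nat) (i j : 'I_n.+1) (p q : 'I_n * 'I_n) :
  pair_lt (lift i p.1, lift j p.2) (lift i q.1, lift j q.2) = pair_lt p q.
Proof. by rewrite /pair_lt ![(_, _).1]/fst ![(_, _).2]/snd !ltn_lift. Qed.

(** Aligning the two last letters extends any alignment of the prefixes. *)
Lemma opt_score_append (R : realDomainType) (s : bool -> bool -> R) (n : nat)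
    (x y : {ffun 'I_n.+1 -> bool}) :
  opt_score s (remove_letter ord_max x) (remove_letter ord_max y)
    + s (x ord_max) (y ord_max) <= opt_score s x y.
Proof.
have [t st ->] := opt_score_attained s (remove_letter ord_max x)
                    (remove_letter ord_max y).
pose f (p : 'I_n * 'I_n) := (lift ord_max p.1, lift ord_max p.2).
have -> : pairs_score s (remove_letter ord_max x) (remove_letter ord_max y) t
    + s (x ord_max) (y ord_max)
    = pairs_score s x y (rcons (map f t) (ord_max, ord_max)).
  rewrite /pairs_score big_rcons big_map /=; congr (_ + _).
  by apply: eq_bigr => p _; rewrite !ffunE.
apply: pairs_score_le_opt.
have lt_f p : pair_lt (f p) (ord_max, ord_max).
  by rewrite /pair_lt !lift_max !ltn_ord.
have : sorted pair_lt (map f t).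
  by rewrite sorted_map; apply: sub_sorted st => p q; rewrite /= pair_lt_lift.
case: t {st} => [|p t] //=; rewrite rcons_path => -> /=.
by rewrite (last_map f).
Qed.

(** At most one aligned pair uses position [i] of [x] and at most one uses position [j] of [y]. Such
    a pair contains a zero, so it scores at most 1 whatever [s true true] is. *)
Lemma opt_score_remove_zeros (R : realDomainType) (s : bool -> bool -> R)
    (n : nat) (i j : 'I_n.+1) (x y : {ffun 'I_n.+1 -> bool}) :
  s true false = 0 -> s false true = 0 -> s false false = 1 ->
  x i = false -> y j = false ->
  opt_score s x y <= opt_score s (remove_letter i x) (remove_letter j y) + 2%:R.
Proof.
move=> s10 s01 s00 xi yj.
have [t st ->] := opt_score_attained s x y.
(* [g] renumbers the pairs that avoid [i] and [j] and drops the others; [f] undoes the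
   renumbering. *)
pose g (p : 'I_n.+1 * 'I_n.+1) : option ('I_n * 'I_n) :=
  if unlift i p.1 is Some a then omap (pair a) (unlift j p.2) else None.
pose f (p : 'I_n * 'I_n) := (lift i p.1, lift j p.2).
pose kept (p : 'I_n.+1 * 'I_n.+1) := (p.1 != i) && (p.2 != j).
have map_g u : map f (pmap g u) = filter kept u.
  elim: u => //= -[k l] u IH; rewrite [g _]/g /kept /=.
  case: (unliftP i k) => [a ->|->]; last by rewrite eqxx IH.
  case: (unliftP j l) => [b ->|->]; last by rewrite eqxx andbF IH.
  by rewrite !(eq_sym (lift _ _)) !neq_lift /= IH.
have sg : sorted pair_lt (pmap g t).
  have : sorted pair_lt (map f (pmap g t)).
    by rewrite map_g; apply: sorted_filter st; apply: pair_lt_trans.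
  by rewrite sorted_map; apply: sub_sorted => p q; rewrite /= pair_lt_lift.
have le1 (u : seq 'I_n.+1) k : uniq u -> \sum_(l <- u) (l == k)%:R <= 1 :> R.
  move=> uu; rewrite -natr_sum lern1.
  have -> : (\sum_(l <- u) (l == k) = count_mem k u)%N.
    by rewrite -sum1_count [RHS]big_mkcond; apply: eq_bigr => l _ /=; case: eqP.
  by rewrite count_uniq_mem // leq_b1.
have := pairs_score_le_opt s (remove_letter i x) (remove_letter j y) sg.
have -> : pairs_score s (remove_letter i x) (remove_letter j y) (pmap g t)
        = pairs_score s x y (filter kept t).
  by rewrite -map_g /pairs_score big_map; apply: eq_bigr => p _; rewrite !ffunE.
have := le1 _ i (sorted_pair_lt_uniq1 st).
have := le1 _ j (sorted_pair_lt_uniq2 st).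
rewrite !big_map.
(* Each dropped pair is charged to the indicators of [i] and [j], whose sums over [t] are at most
   1. *)
suff : pairs_score s x y t <= pairs_score s x y (filter kept t)
   + \sum_(p <- t) (p.1 == i)%:R + \sum_(p <- t) (p.2 == j)%:R by lra.
rewrite /pairs_score big_filter [X in X + _ + _]big_mkcond -!big_split /=.
apply: ler_sum => p _; rewrite /kept.
have sx0 b : s false b <= 1 by case: b; rewrite ?s01 ?s00.
have s0y b : s b false <= 1 by case: b; rewrite ?s10 ?s00.
case: (eqVneq p.1 i) => [->|_]; case: (eqVneq p.2 j) => [->|_] /=;
  rewrite ?xi ?yj; have := sx0 (y p.2); have := s0y (x p.1); lra.
Qed.

(** * Averages over uniform words and conditioning on one letter *)

Definition avg {R : realFieldType} (n : nat) (F : {ffun 'I_n -> bool} -> R) : R :=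
  (2%:R ^+ n)^-1 * \sum_x F x.

Lemma eq_avg (R : realFieldType) (n : nat) (F G : {ffun 'I_n -> bool} -> R) :
  F =1 G -> avg F = avg G.
Proof. by move=> FG; rewrite /avg (eq_bigr _ (fun x _ => FG x)). Qed.

Lemma avgD (R : realFieldType) (n : nat) (F G : {ffun 'I_n -> bool} -> R) :
  avg (fun x => F x + G x) = avg F + avg G.
Proof. by rewrite /avg big_split mulrDr. Qed.

Lemma avgZ (R : realFieldType) (n : nat) (a : R) (F : {ffun 'I_n -> bool} -> R) :
  avg (fun x => a * F x) = a * avg F.
Proof. by rewrite /avg -mulr_sumr mulrCA. Qed.

Lemma avg_cst (R : realFieldType) (n : nat) (a : R) :
  avg (fun _ : {ffun 'I_n -> bool} => a) = a.
Proof.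
rewrite /avg sumr_const card_ffun card_bool card_ord -[a *+ _]mulr_natl natrX.
by rewrite mulKf // expf_neq0 // pnatr_eq0.
Qed.

Lemma le_avg (R : realFieldType) (n : nat) (F G : {ffun 'I_n -> bool} -> R) :
  (forall x, F x <= G x) -> avg F <= avg G.
Proof.
move=> FG; rewrite /avg ler_wpM2l ?ler_sum //.
by rewrite invr_ge0 exprn_ge0 // ler0n.
Qed.

Lemma avg_sum (R : realFieldType) (n : nat) (I : finType)
    (F : I -> {ffun 'I_n -> bool} -> R) :
  avg (fun x => \sum_i F i x) = \sum_i avg (F i).
Proof. by rewrite /avg exchange_big mulr_sumr. Qed.

Definition insert_letter (n : nat) (i : 'I_n.+1) (b : bool)
    (x : {ffun 'I_n -> bool}) : {ffun 'I_n.+1 -> bool} :=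
  [ffun k => if unlift i k is Some l then x l else b].

Lemma insert_letter_at (n : nat) (i : 'I_n.+1) b (x : {ffun 'I_n -> bool}) :
  insert_letter i b x i = b.
Proof. by rewrite ffunE unlift_none. Qed.

Lemma insert_letterK (n : nat) (i : 'I_n.+1) b :
  cancel (insert_letter i b) (remove_letter i).
Proof. by move=> x; apply/ffunP => k; rewrite !ffunE liftK. Qed.

Lemma remove_letterK (n : nat) (i : 'I_n.+1) (x : {ffun 'I_n.+1 -> bool}) :
  insert_letter i (x i) (remove_letter i x) = x.
Proof.
by apply/ffunP => k; rewrite ffunE; case: unliftP => [l ->|->] //; rewrite ffunE.
Qed.

(** Conditioning on the fair letter at [i]: inserting [b] there is a bijection from the shorter
    words onto the words with letter [b] at [i]. *)
Lemma avg_insert (R : realFieldType) (n : nat) (i : 'I_n.+1)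
    (F : {ffun 'I_n.+1 -> bool} -> R) :
  avg F = 2%:R^-1 * (avg (fun x => F (insert_letter i false x))
                     + avg (fun x => F (insert_letter i true x))).
Proof.
rewrite /avg -mulrDr mulrA -invfM -exprS; congr (_ * _).
rewrite (bigID (fun x : {ffun 'I_n.+1 -> bool} => x i)) /= addrC.
congr (_ + _).
- rewrite (reindex_onto (insert_letter i false) (remove_letter i)); last first.
    by move=> x /negbTE xi; rewrite -{2}(remove_letterK i x) xi.
  apply: eq_bigl => x.
  by rewrite insert_letter_at insert_letterK eqxx.
- rewrite (reindex_onto (insert_letter i true) (remove_letter i)); last first.
    by move=> x xi; rewrite -{2}(remove_letterK i x) xi.
  apply: eq_bigl => x.
  by rewrite insert_letter_at insert_letterK eqxx.
Qed.

(** * First two moments of the number of zeros *)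

Definition zeros {R : realFieldType} {n : nat} (x : {ffun 'I_n -> bool}) : R :=
  \sum_i (~~ x i)%:R.

Lemma zeros_insert (R : realFieldType) (n : nat) b (x : {ffun 'I_n -> bool}) :
  zeros (insert_letter ord0 b x) = (~~ b)%:R + zeros x :> R.
Proof.
rewrite /zeros big_ord_recl insert_letter_at; congr (_ + _).
by apply: eq_bigr => i _; rewrite ffunE liftK.
Qed.

Lemma avg_zeros (R : realFieldType) (n : nat) :
  avg (@zeros R n) = n%:R / 2%:R.
Proof.
elim: n => [|n IH].
  by rewrite (eq_avg (G := fun=> 0)) ?avg_cst ?mul0r // => x; rewrite /zeros big_ord0.
rewrite (avg_insert ord0).
rewrite (eq_avg (fun x => zeros_insert R false x)).
rewrite (eq_avg (fun x => zeros_insert R true x)).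
by rewrite !avgD !avg_cst IH /= -natr1; field.
Qed.

(** Second moment of a binomial variable with parameter 1/2, by conditioning on the first letter: a
    zero there turns Z^2 into Z^2 + 2Z + 1. *)
Lemma avg_zeros_sqr (R : realFieldType) (n : nat) :
  avg (fun x => @zeros R n x ^+ 2) = (n%:R ^+ 2 + n%:R) / 4%:R.
Proof.
elim: n => [|n IH].
  rewrite (eq_avg (G := fun=> 0)) ?avg_cst => [|x]; first by rewrite expr0n addr0 mul0r.
  by rewrite /zeros big_ord0 expr0n.
rewrite (avg_insert ord0).
rewrite (eq_avg (G := fun x => zeros x ^+ 2 + (2%:R * zeros x + 1))); last first.
  by move=> x; rewrite zeros_insert /=; ring.
rewrite (eq_avg (F := fun x => zeros (insert_letter ord0 true x) ^+ 2)
  (G := fun x => zeros x ^+ 2)); last by move=> x; rewrite zeros_insert add0r.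
by rewrite !avgD avgZ avg_cst avg_zeros IH -natr1; field.
Qed.

(** * Averages over pairs of independent words *)

Definition avg2 {R : realFieldType} (n : nat)
    (F : {ffun 'I_n -> bool} -> {ffun 'I_n -> bool} -> R) : R :=
  avg (fun x => avg (F x)).

Lemma avg2E (R : realFieldType) (n : nat)
    (F : {ffun 'I_n -> bool} -> {ffun 'I_n -> bool} -> R) :
  (4%:R ^+ n)^-1 * \sum_x \sum_y F x y = avg2 F.
Proof. by rewrite /avg2 /avg -mulr_sumr mulrA -invfM -exprMn -natrM. Qed.

Lemma avg2D (R : realFieldType) (n : nat)
    (F G : {ffun 'I_n -> bool} -> {ffun 'I_n -> bool} -> R) :
  avg2 (fun x y => F x y + G x y) = avg2 F + avg2 G.
Proof. by rewrite /avg2 -avgD; apply: eq_avg => x; rewrite avgD. Qed.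

Lemma avg2Z (R : realFieldType) (n : nat) (a : R)
    (F : {ffun 'I_n -> bool} -> {ffun 'I_n -> bool} -> R) :
  avg2 (fun x y => a * F x y) = a * avg2 F.
Proof. by rewrite /avg2 -avgZ; apply: eq_avg => x; rewrite avgZ. Qed.

Lemma avg2_cst (R : realFieldType) (n : nat) (a : R) :
  avg2 (fun _ _ : {ffun 'I_n -> bool} => a) = a.
Proof. by rewrite /avg2 !avg_cst. Qed.

(** Independence of the two words. *)
Lemma avg2M (R : realFieldType) (n : nat) (F G : {ffun 'I_n -> bool} -> R) :
  avg2 (fun x y => F x * G y) = avg F * avg G.
Proof.
by rewrite /avg2 mulrC -avgZ; apply: eq_avg => x; rewrite avgZ mulrC.
Qed.

Lemma le_avg2 (R : realFieldType) (n : nat)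
    (F G : {ffun 'I_n -> bool} -> {ffun 'I_n -> bool} -> R) :
  (forall x y, F x y <= G x y) -> avg2 F <= avg2 G.
Proof. by move=> FG; apply: le_avg => x; apply: le_avg => y. Qed.

Lemma avg2_insert (R : realFieldType) (n : nat) (i j : 'I_n.+1)
    (F : {ffun 'I_n.+1 -> bool} -> {ffun 'I_n.+1 -> bool} -> R) :
  avg2 F = 4%:R^-1 *
    (avg2 (fun x y => F (insert_letter i false x) (insert_letter j false y))
   + avg2 (fun x y => F (insert_letter i false x) (insert_letter j true y))
   + (avg2 (fun x y => F (insert_letter i true x) (insert_letter j false y))
   + avg2 (fun x y => F (insert_letter i true x) (insert_letter j true y)))).
Proof.
rewrite {1}/avg2 (avg_insert i).
have E b : avg (fun x => avg (F (insert_letter i b x))) = 2%:R^-1 *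
    (avg2 (fun x y => F (insert_letter i b x) (insert_letter j false y))
   + avg2 (fun x y => F (insert_letter i b x) (insert_letter j true y))).
  by rewrite -avg2D -avgZ; apply: eq_avg => x; rewrite (avg_insert j) -avgD.
by rewrite !E; field.
Qed.

(** * Bounds on the mean score and on its correlation with the zeros *)

(** Averaging [opt_score_append] over the four equally likely pairs of last letters gains (1 + 0 + 0
    + s(1,1)) / 4. *)
Lemma mean_LnS_ge (R : realFieldType) (s : bool -> bool -> R) (n : nat) :
  s true false = 0 -> s false true = 0 -> s false false = 1 ->
  mean_Ln s n + (1 + s true true) / 4%:R <= mean_Ln s n.+1.
Proof.
move=> s10 s01 s00; rewrite /mean_Ln !avg2E (avg2_insert ord_max ord_max).
have H b b' : avg2 (fun x y : {ffun 'I_n -> bool} => opt_score s x y) + s b b'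
    <= avg2 (fun x y : {ffun 'I_n -> bool} =>
         opt_score s (insert_letter ord_max b x)
           (insert_letter ord_max b' y)).
  rewrite -[s b b'](avg2_cst n) -avg2D; apply: le_avg2 => x y.
  have := opt_score_append s (insert_letter ord_max b x)
            (insert_letter ord_max b' y).
  by rewrite !insert_letterK !insert_letter_at.
have := H false false; have := H false true.
have := H true false; have := H true true.
by rewrite s10 s01 s00; lra.
Qed.

(** The product of the zero counts is a sum over positions [i], [j] of indicators of two zeros. Each
    such event has probability 1/4, and given it, deleting the two zeros leaves uniform words of
    length [n] at a cost of at most 2. *)
Lemma avg2_zeros_opt_score (R : realFieldType) (s : bool -> bool -> R) (n : nat) :
  s true false = 0 -> s false true = 0 -> s false false = 1 ->
  avg2 (fun x y : {ffun 'I_n.+1 -> bool} => zeros x * zeros y * opt_score s x y)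
    <= n.+1%:R ^+ 2 / 4%:R * (mean_Ln s n + 2%:R).
Proof.
move=> s10 s01 s00.
have H i j : avg2 (fun x y : {ffun 'I_n.+1 -> bool} =>
    (~~ x i)%:R * (~~ y j)%:R * opt_score s x y)
    <= 4%:R^-1 * (mean_Ln s n + 2%:R).
  rewrite (avg2_insert i j) /mean_Ln avg2E ler_wpM2l ?invr_ge0 ?ler0n //.
  (* Of the four letter pairs at [i], [j], only two zeros contribute. *)
  have vanish b b' : b || b' -> avg2 (fun x y : {ffun 'I_n -> bool} =>
      (~~ insert_letter i b x i)%:R * (~~ insert_letter j b' y j)%:R
      * opt_score s (insert_letter i b x) (insert_letter j b' y)) = 0.
    move=> bb'; rewrite -[RHS](avg2_cst n).
    apply: eq_avg => x; apply: eq_avg => y; rewrite !insert_letter_at.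
    by case: b b' bb' => [] [] //= _; rewrite ?mul0r ?mulr0 ?mul0r.
  rewrite (vanish false true) // (vanish true false) // (vanish true true) //.
  rewrite !addr0 -[2%:R](avg2_cst n) -avg2D.
  apply: le_avg2 => x y; rewrite !insert_letter_at !mul1r.
  have := @opt_score_remove_zeros R s n i j (insert_letter i false x)
    (insert_letter j false y) s10 s01 s00.
  by rewrite !insert_letter_at !insert_letterK => /(_ erefl erefl).
have -> : avg2 (fun x y : {ffun 'I_n.+1 -> bool} =>
    zeros x * zeros y * opt_score s x y)
  = \sum_i \sum_j avg2 (fun x y : {ffun 'I_n.+1 -> bool} =>
      (~~ x i)%:R * (~~ y j)%:R * opt_score s x y).
  rewrite /avg2; under eq_bigr do rewrite -avg_sum; rewrite -avg_sum.
  apply: eq_avg => x; under eq_bigr do rewrite -avg_sum; rewrite -avg_sum.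
  apply: eq_avg => y; rewrite /zeros !mulr_suml; apply: eq_bigr => i _.
  by rewrite mulr_sumr mulr_suml.
apply: (le_trans (ler_sum _ (fun i _ => ler_sum _ (fun j _ => H i j)))).
by rewrite !sumr_const card_ord -mulrnA -[X in X <= _]mulr_natr natrM; lra.
Qed.

(** * The linear lower bound on the variance *)

Theorem theorem2p1 (R : realType) :
  exists c : R, exists s0 : R, 0 < c /\ 0 < s0 /\
    forall s : bool -> bool -> R,
      s true false = 0 -> s false true = 0 -> s false false = 1 ->
      s0 <= s true true ->
      forall n : nat, c * n%:R <= var_Ln s n.
Proof.
(* With 11, the growth (1 + 11) / 4 = 3 exceeds the loss 2 by 1, so E(L g) >= 1. For any t >= 0 the
   variance is then at least 2t - 3t^2/N, which is largest at t = N/3 with value N/3. *)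
exists 3%:R^-1, 11%:R; split; [by lra | split; [by lra |]].
move=> s s10 s01 s00 s11 [|n].
  rewrite mulr0 /var_Ln avg2E -[X in X <= _](avg2_cst (R := R) 0).
  by apply: le_avg2 => x y; apply: sqr_ge0.
have growth := mean_LnS_ge n s10 s01 s00.
have weighted := avg2_zeros_opt_score n s10 s01 s00.
set A := avg2 _ in weighted.
rewrite /var_Ln avg2E; set m := mean_Ln s n.+1 in growth *.
have Em : avg2 (fun x y : {ffun 'I_n.+1 -> bool} => opt_score s x y) = m.
  by rewrite -avg2E.
have [N defN] : exists N : R, N = n.+1%:R by exists n.+1%:R.
rewrite -defN in weighted *.
have N_ge1 : 1 <= N by rewrite defN ler1n.
have N_neq0 : N != 0 by rewrite defN pnatr_eq0.
(* [(L - m - t g)^2 >= 0] with [g = 1 - 4 Z(x) Z(y) / N^2], [t = N / 3] *)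
have lower : avg2 (fun x y : {ffun 'I_n.+1 -> bool} =>
    2%:R * N / 3%:R * opt_score s x y
    + (- (2%:R * N / 3%:R * m) - N ^+ 2 / 9%:R
    + (- (8%:R / 3%:R / N) * (zeros x * zeros y * opt_score s x y)
    + ((8%:R / 3%:R / N * m + 8%:R / 9%:R) * (zeros x * zeros y)
    + - (16%:R / 9%:R / N ^+ 2) * (zeros x ^+ 2 * zeros y ^+ 2)))))
    <= avg2 (fun x y : {ffun 'I_n.+1 -> bool} => (opt_score s x y - m) ^+ 2).
  (* The lower integrand is 2t(L - m)g - t^2 g^2, expanded so that each term can be averaged
     separately. *)
  apply: le_avg2 => x y; rewrite -subr_ge0.
  have -> : forall L Z Z' : R, (L - m) ^+ 2 - (2%:R * N / 3%:R * L
    + (- (2%:R * N / 3%:R * m) - N ^+ 2 / 9%:R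
    + (- (8%:R / 3%:R / N) * (Z * Z' * L)
    + ((8%:R / 3%:R / N * m + 8%:R / 9%:R) * (Z * Z')
    + - (16%:R / 9%:R / N ^+ 2) * (Z ^+ 2 * Z' ^+ 2)))))
    = (L - m - N / 3%:R * (1 - 4%:R * Z * Z' / N ^+ 2)) ^+ 2.
    by move=> L Z Z'; field.
  exact: sqr_ge0.
apply: le_trans lower.
rewrite !avg2D !avg2Z !avg2_cst Em !avg2M avg_zeros avg_zeros_sqr -/A -defN.
(* Here [growth] is used: E L_n + 2 <= m - 1. *)
have A_le : A <= N ^+ 2 / 4%:R * (m - 1).
  apply: (le_trans weighted); rewrite ler_wpM2l ?divr_ge0 ?sqr_ge0 //; lra.
have : 8%:R / 3%:R / N * A <= 8%:R / 3%:R / N * (N ^+ 2 / 4%:R * (m - 1)).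
  by rewrite ler_wpM2l // !divr_ge0 // ?ler0n //; lra.
have -> : 8%:R / 3%:R / N * (N ^+ 2 / 4%:R * (m - 1)) = 2%:R / 3%:R * N * (m - 1).
  by field.
have -> : (8%:R / 3%:R / N * m + 8%:R / 9%:R) * (N / 2%:R * (N / 2%:R))
  = 2%:R / 3%:R * N * m + 2%:R / 9%:R * N ^+ 2 by field.
have -> : - (16%:R / 9%:R / N ^+ 2) * ((N ^+ 2 + N) / 4%:R * ((N ^+ 2 + N) / 4%:R))
  = - (N ^+ 2 + 2%:R * N + 1) / 9%:R by field.
(* The terms in m and N^2 cancel, leaving 2N/3 - (2N + 1)/9 >= N/3, which amounts to N >= 1. *)
by lra.
Qed.
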